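(* Let $f:\mathbb{R}^n_{>0}\to\mathbb{R}^n_{>0}$ be in the class $\mathcal{M}_+$. Then $f$ has an eigenvector in $\mathbb{R}^n_{>0}$ if and only if $f$ is strongly nonnegative. If $f$ does have an eigenvector in $\mathbb{R}^n_{>0}$, then it is unique up to scaling if and only if $\mathcal{G}(f)$ has a unique final class.
   Context: For $r\in\mathbb{R}$ and a probability vector $\sigma\in\mathbb{R}^n_{\ge0}$ ($\sum_i\sigma_i=1$), the $(r,\sigma)$-mean of $x\in\mathbb{R}^n_{\ge0}$ is $M_{r\sigma}(x)=(\sum_i\sigma_ix_i^r)^{1/r}$ if $r\ne0$, and $M_{0\sigma}(x)=\prod_{i:\sigma_i>0}x_i^{\sigma_i}$. Class $M_+$: maps $f:\mathbb{R}^n_{\ge0}\to\mathbb{R}^n_{>0}$ each of whose entries is a positive linear combination of $(r,\sigma)$-means with $r\ge0$. Class $\mathcal{M}_+$: the smallest class of maps $\mathbb{R}^n_{\ge0}\to\mathbb{R}^n_{\ge0}$ containing $M_+$ and closed under addition and composition; $f$ in the claim is (the restriction to $\mathbb{R}^n_{>0}$ of) such a map. Such $f$ are order-preserving and homogeneous. $P^J_0(x)_j=x_j$ for $j\in J$, $0$ otherwise; $f^J_0=P^J_0fP^J_0$; $r(g)=\inf_{x\in\mathbb{R}^n_{>0}}\max_ig(x)_i/x_i$. $\mathcal{G}(f)$ is the directed graph on $[n]$ with an arc $i\to j$ when $\lim_{t\to\infty}f(\exp(te_{\{j\}}))_i=\infty$. A final class is a strongly connected component with no arcs leaving it. $f$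 is strongly nonnegative if $r(f^C_0)=r(f)$ for every final class $C$ and $r(f^C_0)<r(f)$ for every non-final strongly connected component $C$. An eigenvector of $f$ in $\mathbb{R}^n_{>0}$ is $x\in\mathbb{R}^n_{>0}$ with $f(x)=\mu x$. *)

(* Defs.v *)
From HB Require Import structures.
From mathcomp Require Import all_boot all_order all_algebra.
From mathcomp Require Import all_classical all_reals all_analysis.
Set Implicit Arguments. Unset Strict Implicit. Unset Printing Implicit Defensive.
Import Order.TTheory GRing.Theory Num.Theory.
Local Open Scope classical_set_scope.
Local Open Scope ring_scope.

Section Defs.
Context {R : realType} {n : nat}.
Notation vec := ('I_n -> R).

Definition probvec (s : vec) : Prop := (forall i, 0 <= s i) /\ \sum_i s i = 1.

(* the (r,sigma)-mean, with 0 `^ r = 0 for r > 0 and 0 `^ 0 = 1 (powR) *)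
Definition rmean (r : R) (s : vec) (x : vec) : R :=
  if r == 0 then \prod_(i | 0 < s i) (x i `^ s i)
  else (\sum_i s i * x i `^ r) `^ r^-1.

Definition inMp (f : vec -> vec) : Prop :=
  forall i : 'I_n, exists s : seq (R * R * vec),
    s != [::] /\
    (forall t, t \in s -> 0 < t.1.1 /\ 0 <= t.1.2 /\ probvec t.2) /\
    (forall x, f x i = \sum_(t <- s) t.1.1 * rmean t.1.2 t.2 x).

Inductive inMcalp : (vec -> vec) -> Prop :=
| inMcalp_base f : inMp f -> inMcalp f
| inMcalp_add f g : inMcalp f -> inMcalp g -> inMcalp (fun x i => f x i + g x i)
| inMcalp_comp f g : inMcalp f -> inMcalp g -> inMcalp (fun x => f (g x)).

Definition posvec (x : vec) : Prop := forall i, 0 < x i.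

Definition PJ0 (J : {set 'I_n}) (x : vec) : vec := fun j => if j \in J then x j else 0.
Definition fJ0 (J : {set 'I_n}) (f : vec -> vec) : vec -> vec := fun x => PJ0 J (f (PJ0 J x)).

Definition cw_radius (g : vec -> vec) : R :=
  inf [set y | exists x, posvec x /\ y = \big[Num.max/0]_i (g x i / x i)].

Definition expvec (t : R) (j : 'I_n) : vec := fun k => if k == j then expR t else 1.

Definition arc (f : vec -> vec) (i j : 'I_n) : Prop :=
  (fun t : R => f (expvec t j) i) @ +oo --> +oo.

Definition arcb (f : vec -> vec) : rel 'I_n := fun i j => `[< arc f i j >].

Definition scc (f : vec -> vec) (i : 'I_n) : {set 'I_n} :=
  [set j | connect (arcb f) i j && connect (arcb f) j i].

Definition is_scc (f : vec -> vec) (C : {set 'I_n}) : Prop := exists i, C = scc f i.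

Definition final_class (f : vec -> vec) (C : {set 'I_n}) : Prop :=
  is_scc f C /\ (forall a b, a \in C -> arc f a b -> b \in C).

Definition strongly_nonneg (f : vec -> vec) : Prop :=
  forall C, is_scc f C ->
    (final_class f C -> cw_radius (fJ0 C f) = cw_radius f) /\
    (~ final_class f C -> cw_radius (fJ0 C f) < cw_radius f).

Definition pos_eigvec (f : vec -> vec) (x : vec) : Prop :=
  posvec x /\ exists mu : R, f x = (fun i => mu * x i).

End Defs.

(* Main.v *)
(* Writing [D i] for the set of variables on which [f_i] depends, every map of
   the class is monotone, homogeneous, strictly increasing in the variables of
   [D i] and coercive in them on [x >= 1], so the arcs of [G(f)] are exactly the
   pairs [j \in D i]; log-convexity is not needed beyond this.
   If [f x <= mu x] on a class [C] with a strict inequality somewhere, shrinking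
   [x] slightly on the strict set propagates strictness backwards along arcs,
   hence [r(f^C_0) < mu]. This handles non-final classes (where zeroing the other
   variables creates a strict inequality) and, conversely, upgrades an optimal
   [x] on a final class to an eigenvector; an optimal [x] exists because
   coercivity along paths bounds all [x] with [f x <= lam x].
   Given eigenvectors on the final classes, a positive [x] with [f x <= mu x] is
   built by adding the non-final classes one at a time, each with a large enough
   multiple of a vector [y] satisfying [f^C_0 y < mu y]. The infimum of all such
   [x] with the same values on the final classes is an eigenvector (Knaster and
   Tarski). For uniqueness, the set where the ratio of two eigenvectors is
   minimal is closed under arcs, so it contains a final class; with two final
   classes, the values on one of them can be rescaled independently. *)
Require Import Defs.
From HB Require Import structures.
From mathcomp Require Import all_boot all_order all_algebra.
From mathcomp Require Import all_classical all_reals all_analysis.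
From mathcomp Require Import ring lra.
Import Order.TTheory GRing.Theory Num.Theory.
Local Open Scope ring_scope.

(** * Uniform thresholds over a finite index set *)

Section FiniteBounds.
Context {R : realType} {I : finType}.

(** Each [P i] holds on a whole interval below its threshold, so the minimum of the thresholds
    serves all indices; the default 1 covers an empty [I]. *)
Lemma fin_small (P : I -> R -> Prop) :
  (forall i, exists2 d, 0 < d & forall d', 0 < d' <= d -> P i d') ->
  exists2 d, 0 < d & forall i, P i d.
Proof.
move=> H; have /choice[d dP] : forall i, exists d, 0 < d /\
    forall d', 0 < d' <= d -> P i d'.
  by move=> i; have [d] := H i; exists d.
exists (\big[Num.min/1]_i d i).
  by apply: lt_bigmin => // i _; case: (dP i).
move=> i; apply: (dP i).2; rewrite bigmin_le andbT.
by apply: lt_bigmin => // j _; case: (dP j).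
Qed.

Lemma fin_large (P : I -> R -> Prop) :
  (forall i, exists A, forall A', A <= A' -> P i A') ->
  exists2 A, 1 <= A & forall i, P i A.
Proof.
move=> /choice[A AP]; exists (\big[Num.max/1]_i A i); first exact: bigmax_ge_id.
by move=> i; apply: AP; apply: le_bigmax.
Qed.

End FiniteBounds.

(** * Regular functions, and the regularity of all maps of the class *)

Section Regular.
Context {R : realType} {n : nat}.
Notation vec := ('I_n -> R).

Definition nneg (x : vec) : Prop := forall i, 0 <= x i.

Lemma posvec_nneg (x : vec) : posvec x -> nneg x.
Proof. by move=> x0 i; exact: ltW. Qed.

(* [P] is the set of variables on which [h] actually depends. The last two
   fields replace continuity on the closed orthant and log-convexity. *)
Record regular (h : vec -> R) (P : pred 'I_n) : Prop := Regular {
  reg_ge0 : forall x, nneg x -> 0 <= h x;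
  reg_gt0 : forall x, posvec x -> 0 < h x;
  reg_mono : forall x y, nneg x -> (forall i, x i <= y i) -> h x <= h y;
  reg_hom : forall c x, 0 < c -> nneg x -> h (fun i => c * x i) = c * h x;
  reg_dep : forall x y, nneg x -> nneg y ->
    (forall j, P j -> x j = y j) -> h x = h y;
  reg_strict : forall x y j, posvec x -> (forall i, x i <= y i) ->
    P j -> x j < y j -> h x < h y;
  reg_coercive : forall j B, P j -> exists A, forall x,
    (forall i, 1 <= x i) -> h x <= B -> x j <= A;
  reg_usc : forall z c, nneg z -> h z < c ->
    exists2 d, 0 < d & h (fun i => z i + d) <= c }.

Definition regular_map (f : vec -> vec) (D : rel 'I_n) : Prop :=
  forall i, regular (f^~ i) (D i).

Lemma nneg_le {x y : vec} : nneg x -> (forall i, x i <= y i) -> nneg y.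
Proof. by move=> x0 xy i; apply: le_trans (xy i). Qed.

Lemma posvec_le {x y : vec} : posvec x -> (forall i, x i <= y i) -> posvec y.
Proof. by move=> x0 xy i; apply: lt_le_trans (xy i). Qed.

Lemma nneg_ge1 {x : vec} : (forall i, 1 <= x i) -> nneg x.
Proof. by move=> x1 i; apply: le_trans (x1 i). Qed.

Lemma nnegD (z : vec) d : nneg z -> 0 <= d -> nneg (fun i => z i + d).
Proof. by move=> z0 d0 i; rewrite addr_ge0. Qed.

Lemma regular_scale a h P : 0 < a -> regular h P ->
  regular (fun x => a * h x) P.
Proof.
move=> a0 [h1 h2 h3 h4 h5 h6 h7 h8]; split.
- by move=> x x0; rewrite mulr_ge0 ?h1// ltW.
- by move=> x x0; rewrite mulr_gt0// h2.
- by move=> x y x0 xy; rewrite ler_pM2l// h3.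
- by move=> c x c0 x0; rewrite h4// mulrCA.
- by move=> x y x0 y0 xy; rewrite (h5 x y).
- by move=> x y j x0 xy Pj xyj; rewrite ltr_pM2l// (h6 x y j).
- move=> j B Pj; have [A HA] := h7 j (B / a) Pj.
  exists A => x x1 hB; apply: HA => //.
  by rewrite ler_pdivlMr// mulrC.
- move=> z c z0; rewrite mulrC -ltr_pdivlMr// => /(h8 _ _ z0)[d d0 hd].
  by exists d => //; rewrite mulrC -ler_pdivlMr.
Qed.

Lemma regularD h P k Q : regular h P -> regular k Q ->
  regular (fun x => h x + k x) (predU P Q).
Proof.
move=> [h1 h2 h3 h4 h5 h6 h7 h8] [k1 k2 k3 k4 k5 k6 k7 k8]; split.
- by move=> x x0; rewrite addr_ge0 ?h1 ?k1.
- by move=> x x0; rewrite addr_gt0 ?h2 ?k2.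
- by move=> x y x0 xy; rewrite lerD ?h3 ?k3.
- by move=> c x c0 x0; rewrite h4// k4// mulrDr.
- move=> x y x0 y0 xy; rewrite (h5 x y) ?(k5 x y)// => j Pj; apply: xy => /=.
    by apply/orP; right.
  by apply/orP; left.
- move=> x y j x0 xy /orP[] Pj xyj.
    by rewrite ltr_leD// ?k3 ?(h6 x y j)//; exact: posvec_nneg.
  by rewrite ler_ltD// ?h3 ?(k6 x y j)//; exact: posvec_nneg.
- move=> j B /orP[] Pj.
    have [A HA] := h7 j B Pj; exists A => x x1 hB; apply: HA => //.
    by apply: le_trans hB; rewrite lerDl k1//; exact: nneg_ge1.
  have [A HA] := k7 j B Pj; exists A => x x1 hB; apply: HA => //.
  by apply: le_trans hB; rewrite lerDr h1//; exact: nneg_ge1.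
- move=> z c z0 hkc; set e := (c - (h z + k z)) / 2.
  have e0 : 0 < e by rewrite /e divr_gt0// subr_gt0.
  have [d1 d10 H1] : exists2 d, 0 < d & h (fun i => z i + d) <= h z + e.
    by apply: h8 => //; rewrite ltrDl.
  have [d2 d20 H2] : exists2 d, 0 < d & k (fun i => z i + d) <= k z + e.
    by apply: k8 => //; rewrite ltrDl.
  have d0 : 0 < Num.min d1 d2 by rewrite lt_min d10.
  exists (Num.min d1 d2) => //.
  have -> : c = (h z + e) + (k z + e) by rewrite /e; lra.
  apply: lerD.
    apply: le_trans H1; apply: h3; first exact/nnegD/ltW.
    by move=> i; rewrite lerD2l ge_min lexx.
  apply: le_trans H2; apply: k3; first exact/nnegD/ltW.
  by move=> i; rewrite lerD2l ge_min lexx orbT.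
Qed.

Lemma regular_comp h P g E : regular h P -> regular_map g E ->
  regular (fun x => h (g x)) (fun j => [exists k, P k && E k j]).
Proof.
move=> [h1 h2 h3 h4 h5 h6 h7 h8] rg.
have g0 x : nneg x -> nneg (g x) by move=> x0 i; exact: (reg_ge0 _ _ (rg i)).
have gp x : posvec x -> posvec (g x) by move=> x0 i; exact: (reg_gt0 _ _ (rg i)).
have gm x y : nneg x -> (forall i, x i <= y i) -> forall i, g x i <= g y i.
  by move=> x0 xy i; exact: (reg_mono _ _ (rg i)).
split.
- by move=> x x0; apply: h1; exact: g0.
- by move=> x x0; apply: h2; exact: gp.
- by move=> x y x0 xy; apply: h3; [exact: g0|exact: gm].
- move=> c x c0 x0; rewrite -h4//; last exact: g0.
  by congr h; apply/funext => i; exact: (reg_hom _ _ (rg i)).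
- move=> x y x0 y0 xy; apply: h5; [exact: g0|exact: g0|move=> k Pk].
  apply: (reg_dep _ _ (rg k)) => // j Ej; apply: xy.
  by apply/existsP; exists k; rewrite Pk.
- move=> x y j x0 xy /existsP[k /andP[Pk Ek]] xyj.
  apply: (h6 _ _ k) => //; first exact: gp.
    by apply: gm => //; exact: posvec_nneg.
  exact: (reg_strict _ _ (rg k) x y j).
- move=> j B /existsP[k /andP[Pk Ek]].
  (* Coercivity of [h] concerns vectors with entries at least 1. So [g x] is divided by the lower
     bound [a] of [g] at the all-ones vector, and homogeneity of [h] moves this factor to [B]. *)
  have [a a0 ga] : exists2 a, 0 < a & forall i, a <= g (fun=> 1) i.
    apply: fin_small => i; exists (g (fun=> 1) i); last by move=> d /andP[].
    by apply: gp => ?; exact: ltr01.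
  have [A HA] := h7 k (B / a) Pk.
  have [A' HA'] := reg_coercive _ _ (rg k) j (a * A) Ek.
  exists A' => x x1 hB; apply: HA' => //; rewrite -ler_pdivrMl//.
  apply: (HA (fun i => a^-1 * g x i)).
    move=> i; rewrite ler_pdivlMl// mulr1.
    by apply: le_trans (ga i) _; apply: gm => // ?; exact: ler01.
  rewrite h4 ?invr_gt0//; last exact/g0/nneg_ge1.
  by rewrite mulrC ler_pM2r ?invr_gt0.
- move=> z c z0 /(h8 _ _ (g0 _ z0))[e e0 he].
  have [d d0 Hd] : exists2 d, 0 < d &
      forall i, g (fun j => z j + d) i <= g z i + e.
    apply: fin_small => i.
    have [|d d0 Hd] := reg_usc _ _ (rg i) z (g z i + e) z0; first by rewrite ltrDl.
    exists d => // d' /andP[d'0 d'd]; apply: le_trans Hd.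
    apply: (reg_mono _ _ (rg i)); first exact/nnegD/ltW.
    by move=> j; rewrite lerD2l.
  exists d => //; apply: le_trans he; apply: h3 => //.
  exact/g0/nnegD/ltW.
Qed.

Lemma powR_usc (p a c : R) : 0 < p -> 0 <= a -> a `^ p < c ->
  exists2 d, 0 < d & forall d', 0 < d' <= d -> (a + d') `^ p <= c.
Proof.
move=> p0 a0 apc; have c0 : 0 < c := le_lt_trans (powR_ge0 _ _) apc.
have pV : c = (c `^ p^-1) `^ p.
  by rewrite -powRrM mulVf ?gt_eqF// powRr1// ltW.
exists (c `^ p^-1 - a).
  rewrite subr_gt0 ltNge; apply/negP => H; move: apc; rewrite ltNge => /negP; apply.
  by rewrite {1}pV ge0_ler_powR ?nnegrE ?powR_ge0 ?(ltW p0).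
move=> d /andP[d0 dc]; rewrite pV; apply: ge0_ler_powR.
- exact: ltW.
- by rewrite nnegrE addr_ge0// ltW.
- by rewrite nnegrE powR_ge0.
- by rewrite -lerBrDl.
Qed.

Lemma powR_le_inv (p a B : R) : 0 < p -> 0 <= a -> a `^ p <= B ->
  a <= B `^ p^-1.
Proof.
move=> p0 a0 apB.
have {1}-> : a = (a `^ p) `^ p^-1 by rewrite -powRrM mulfV ?gt_eqF// powRr1.
have B0 : 0 <= B := le_trans (powR_ge0 _ _) apB.
by rewrite ge0_ler_powR ?nnegrE ?powR_ge0 ?invr_ge0 ?(ltW p0).
Qed.

Lemma powR_sum (I : finType) (P : pred I) (c : R) (w : I -> R) : 0 < c ->
  \prod_(i | P i) c `^ w i = c `^ (\sum_(i | P i) w i).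
Proof.
move=> c0; elim/big_rec2: _ => [|i y1 y2 _ ->]; first by rewrite powRr0.
by rewrite powRD ?(gt_eqF c0) ?implybT.
Qed.

(** Stated for a sequence of indices so that the factors can be treated one at a time by
    induction. *)
Lemma prod_powR_usc (w z : vec) (s : seq 'I_n) (c : R) : nneg z ->
  \prod_(i <- s | 0 < w i) z i `^ w i < c ->
  exists2 d, 0 < d & forall d', 0 < d' <= d ->
    \prod_(i <- s | 0 < w i) (z i + d') `^ w i <= c.
Proof.
move=> z0; elim: s c => [|i s IH] c.
  by rewrite big_nil => c1; exists 1 => // d' _; rewrite big_nil ltW.
rewrite big_cons; case: ifP => wi pc; last first.
  by have [d d0 Hd] := IH _ pc; exists d => // d' d'd; rewrite big_cons wi Hd.
set p := z i `^ w i in pc; set q := \prod_(j <- s | _) _ in pc IH.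
have p0 : 0 <= p := powR_ge0 _ _.
have q0 : 0 <= q by apply: prodr_ge0 => j _; exact: powR_ge0.
(* As [e <= 1], the product [(p + e) * (q + e)] is at most [p * q + e * (p + q + 1)], which this
   choice keeps at most [c]. *)
pose e := Num.min 1 ((c - p * q) / (p + q + 1)).
have pq1 : 0 < p + q + 1 by lra.
have e0 : 0 < e by rewrite /e lt_min ltr01 divr_gt0// subr_gt0.
have e1 : e <= 1 by rewrite /e ge_min lexx.
have ec : e * (p + q + 1) <= c - p * q.
  by rewrite -ler_pdivlMr// /e ge_min lexx orbT.
have [|d1 d10 H1] := @powR_usc (w i) (z i) (p + e) wi (z0 i).
  by rewrite ltrDl.
have [|d2 d20 H2] := IH (q + e); first by rewrite ltrDl.
exists (Num.min d1 d2); first by rewrite lt_min d10.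
move=> d /andP[d0]; rewrite le_min => /andP[dd1 dd2].
rewrite big_cons wi; apply: (@le_trans _ _ ((p + e) * (q + e))); last by nra.
apply: ler_pM; rewrite ?powR_ge0//.
- by apply: prodr_ge0 => j _; exact: powR_ge0.
- by apply: H1; rewrite d0.
- by apply: H2; rewrite d0.
Qed.

Lemma probvec_gt0 (s : vec) : probvec s -> exists j, 0 < s j.
Proof.
move=> [s0 s1]; have [//|Hn] := pselect (exists j, 0 < s j).
suff : \sum_i s i = 0 by rewrite s1 => /eqP; rewrite oner_eq0.
apply: big1 => i _; apply/eqP; rewrite eq_le s0 andbT leNgt.
by apply/negP => si; apply: Hn; exists i.
Qed.

Lemma regular_geometric_mean (s : vec) : probvec s ->
  regular (fun x => \prod_(i | 0 < s i) x i `^ s i) (fun i => 0 < s i).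
Proof.
move=> sP; have [s0 s1] := sP; split.
- by move=> x x0; apply: prodr_ge0 => i _; exact: powR_ge0.
- by move=> x x0; apply: prodr_gt0 => i _; exact: powR_gt0.
- move=> x y x0 xy; apply: ler_prod => i _.
  by rewrite powR_ge0 ge0_ler_powR ?nnegrE ?(nneg_le x0 xy i).
- move=> c x c0 x0.
  under eq_bigr => i _ do rewrite powRM ?(ltW c0) ?x0//.
  rewrite big_split/= powR_sum//; congr (_ * _).
  suff -> : \sum_(i | 0 < s i) s i = 1 by rewrite powRr1// ltW.
  rewrite -s1 [RHS](bigID (fun i => 0 < s i))/= [X in _ = _ + X]big1 ?addr0//.
  by move=> i; rewrite -leNgt => si; apply/eqP; rewrite eq_le si s0.
- by move=> x y x0 y0 xy; apply: eq_bigr => i si; rewrite xy.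
- move=> x y j x0 xy sj xyj; have y0 := posvec_le x0 xy.
  rewrite (bigD1 j)//= [X in _ < X](bigD1 j)//=.
  apply: (@lt_le_trans _ _ (y j `^ s j * \prod_(i | (0 < s i) && (i != j)) x i `^ s i)).
    rewrite ltr_pM2r; last by apply: prodr_gt0 => i _; exact: powR_gt0.
    by rewrite gt0_ltr_powR ?nnegrE ?ltW.
  rewrite ler_wpM2l ?powR_ge0//; apply: ler_prod => i _.
  by rewrite powR_ge0 ge0_ler_powR ?nnegrE ?(posvec_nneg _ y0) ?(posvec_nneg _ x0).
(* On [x >= 1] the other factors are at least 1, so the product dominates the factor of [j]. *)
- move=> j B sj; exists (B `^ (s j)^-1) => x x1 hB.
  apply: powR_le_inv => //; first exact: nneg_ge1.
  apply: le_trans hB; rewrite (bigD1 j)//= ler_peMr ?powR_ge0//.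
  elim/big_ind: _ => // [u v u1 v1|i /andP[si _]]; first exact: mulr_ege1.
  have -> : 1 = 1 `^ s i :> R by rewrite powR1.
  by rewrite ge0_ler_powR ?nnegrE ?(nneg_ge1 x1 i).
- move=> z c z0 zc; have [d d0 Hd] := @prod_powR_usc s z _ c z0 zc.
  by exists d => //; apply: Hd; rewrite d0 lexx.
Qed.

Lemma regular_power_mean (r : R) (s : vec) : 0 < r -> probvec s ->
  regular (fun x => (\sum_i s i * x i `^ r) `^ r^-1) (fun i => 0 < s i).
Proof.
move=> r0 sP; have [s0 s1] := sP; have [k sk] := probvec_gt0 _ sP.
have rV0 : 0 < r^-1 by rewrite invr_gt0.
have term0 (x : vec) i : 0 <= s i * x i `^ r by rewrite mulr_ge0 ?powR_ge0.
have S0 (x : vec) : 0 <= \sum_i s i * x i `^ r by apply: sumr_ge0.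
have termS (x : vec) i : s i * x i `^ r <= \sum_i s i * x i `^ r.
  by rewrite (bigD1 i)//= lerDl; apply: sumr_ge0.
have termM (x y : vec) i : nneg x -> (forall i, x i <= y i) ->
    s i * x i `^ r <= s i * y i `^ r.
  move=> x0 xy; rewrite ler_wpM2l//.
  by rewrite ge0_ler_powR ?nnegrE ?(nneg_le x0 xy i) ?(ltW r0).
split.
- by move=> x x0; exact: powR_ge0.
- move=> x x0; apply: powR_gt0; apply: lt_le_trans (termS x k).
  by rewrite mulr_gt0 ?powR_gt0.
- move=> x y x0 xy; rewrite ge0_ler_powR ?nnegrE ?(ltW rV0)//.
  by apply: ler_sum => i _; exact: termM.
- move=> c x c0 x0.
  under eq_bigr => i _ do rewrite powRM ?(ltW c0) ?x0// mulrCA.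
  rewrite -mulr_sumr powRM ?powR_ge0// -powRrM mulfV ?gt_eqF//.
  by rewrite powRr1// ltW.
- move=> x y x0 y0 xy; congr (_ `^ _); apply: eq_bigr => i _.
  have [si|si] := ltP 0 (s i); first by rewrite xy.
  by have -> : s i = 0; [apply/eqP; rewrite eq_le si s0|rewrite !mul0r].
- move=> x y j x0 xy sj xyj; rewrite gt0_ltr_powR ?nnegrE//.
  rewrite (bigD1 j)//= [X in _ < X](bigD1 j)//= ltr_leD//.
    by rewrite ltr_pM2l// gt0_ltr_powR ?nnegrE ?ltW ?(posvec_le x0 xy j).
  by apply: ler_sum => i _; apply: termM => //; exact: posvec_nneg.
- move=> j B sj; exists ((B `^ r / s j) `^ r^-1) => x x1 hB.
  apply: powR_le_inv => //; first exact: nneg_ge1.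
  rewrite ler_pdivlMr// mulrC; apply: le_trans (termS x j) _.
  have := powR_le_inv _ _ _ rV0 (S0 x) hB.
  by rewrite invrK.
- move=> z c z0 zc; have c0 : 0 < c := le_lt_trans (powR_ge0 _ _) zc.
  (* The slack is measured before the outer root is taken. Since the weights sum to 1, adding [e] to
     every r-th power raises the weighted sum by exactly [e]. *)
  pose e := c `^ r - \sum_i s i * z i `^ r.
  have Sc : c = (c `^ r) `^ r^-1 by rewrite -powRrM mulfV ?gt_eqF// powRr1// ltW.
  have e0 : 0 < e.
    rewrite subr_gt0 ltNge; apply/negP => H; move: zc.
    rewrite ltNge => /negP; apply.
    by rewrite {1}Sc ge0_ler_powR ?nnegrE ?powR_ge0 ?(ltW rV0).
  have [d d0 Hd] : exists2 d, 0 < d &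
      forall i, (z i + d) `^ r <= z i `^ r + e.
    by apply: fin_small => i; apply: powR_usc => //; rewrite ltrDl.
  exists d; [exact: d0|rewrite [leRHS]Sc; apply: ge0_ler_powR].
  - exact: ltW.
  - by rewrite nnegrE; exact: S0 (fun i => z i + d).
  - by rewrite nnegrE powR_ge0.
  have -> : c `^ r = \sum_i s i * (z i `^ r + e).
    under eq_bigr => i _ do rewrite mulrDr.
    by rewrite big_split/= -mulr_suml s1 mul1r /e addrC subrK.
  by apply: ler_sum => i _; rewrite ler_wpM2l.
Qed.

Lemma regular_rmean (r : R) (s : vec) : 0 <= r -> probvec s ->
  regular (rmean r s) (fun i => 0 < s i).
Proof.
rewrite /rmean le_eqVlt => /orP[/eqP <-|r0] sP.
  rewrite eqxx; exact: regular_geometric_mean sP.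
rewrite (gt_eqF r0); exact: regular_power_mean r0 sP.
Qed.

(** The induction ends at a one-element list: the empty sum is zero and would violate [reg_gt0]. *)
Lemma regular_sum (s : seq (R * R * vec)) : s != [::] ->
  (forall t, t \in s -> 0 < t.1.1 /\ 0 <= t.1.2 /\ probvec t.2) ->
  exists P, regular (fun x => \sum_(t <- s) t.1.1 * rmean t.1.2 t.2 x) P.
Proof.
elim: s => // t s IH _ sP.
have [t1 [t2 t3]] := sP t (mem_head _ _).
have rt := regular_scale _ _ _ t1 (regular_rmean _ _ t2 t3).
have [s0|s0] := eqVneq s [::].
  eexists; rewrite s0; under eq_fun do rewrite big_seq1; exact: rt.
have [|P rP] := IH s0; first by move=> u us; apply: sP; rewrite in_cons us orbT.
by eexists; under eq_fun do rewrite big_cons; exact: (regularD _ _ _ _ rt rP).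
Qed.

(** Everything that the later arguments use of the class passes through this lemma. *)
Lemma inMcalp_regular (f : vec -> vec) : inMcalp f ->
  exists D, regular_map f D.
Proof.
elim=> {f} [f fM|f g _ [D fD] _ [E gE]|f g _ [D fD] _ [E gE]].
- have /choice[D fD] : forall i, exists P, regular (f^~ i) P.
    move=> i; have [s [s0 [sP fs]]] := fM i.
    have [P rP] := regular_sum s s0 sP; exists P.
    have -> : f^~ i = fun x => \sum_(t <- s) t.1.1 * rmean t.1.2 t.2 x by apply/funext.
    exact: rP.
  by exists D.
- by exists (fun i => predU (D i) (E i)) => i; exact: regularD.
- exists (fun i j => [exists k, D i k && E k j]) => i.
  exact: (regular_comp _ _ _ _ (fD i) gE).
Qed.

(** If row [i] ignores the variable [j], it is constant along [expvec t j]. Otherwise coercivity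
    applies, since [expvec t j] has entries at least 1 for [t >= 0], and [expR t] exceeds any bound
    [A] once [t >= A]. *)
Lemma regular_arc f D : regular_map f D -> arcb f = D.
Proof.
move=> rf; apply/funext => i; apply/funext => j; apply/idP/idP.
- move=> /asboolP fij; apply/negPn/negP => nD.
  have ft t : f (expvec t j) i = f (expvec 0 j) i.
    apply: (reg_dep _ _ (rf i)).
    + by move=> k; rewrite /expvec; case: ifP => // _; exact: expR_ge0.
    + by move=> k; rewrite /expvec; case: ifP => // _; exact: expR_ge0.
    + move=> k Dk; rewrite /expvec; case: eqP => // kj.
      by rewrite kj (negbTE nD) in Dk.
  have /cvgryPgt/(_ (f (expvec 0 j) i)) := fij.
  move=> /filter_ex[t]; rewrite ft; by rewrite ltxx.
- move=> Dij; apply/asboolP; apply/cvgryPge => B.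
  have [A HA] := reg_coercive _ _ (rf i) j B Dij.
  near=> t; rewrite leNgt; apply/negP => fB.
  have t0 : 0 <= t by near: t; apply: nbhs_pinfty_ge; exact: num_real.
  have tA : A <= t by near: t; apply: nbhs_pinfty_ge; exact: num_real.
  have : expvec t j j <= A.
    apply: HA; last exact: ltW.
    by move=> k; rewrite /expvec; case: ifP => // _; rewrite -expR0 ler_expR.
  rewrite /expvec eqxx; apply/negP; rewrite -ltNge; apply: le_lt_trans tA _.
  by apply: lt_le_trans (expR_ge1Dx _); rewrite ltrDr.
Unshelve. all: by end_near.
Qed.

End Regular.

(** * Upper and lower bounds for the Collatz-Wielandt radius *)

Section CollatzWielandt.
Context {R : realType} {n : nat}.
Notation vec := ('I_n -> R).
Implicit Types (g : vec -> vec) (x : vec).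

Let ratios g : set R :=
  [set y | exists x, posvec x /\ y = \big[Num.max/0]_i (g x i / x i)]%classic.

Let ratios_neq0 g : (ratios g !=set0)%classic.
Proof.
exists (\big[Num.max/0]_i (g (fun=> 1) i / 1)); exists (fun=> 1).
by split => // i; exact: ltr01.
Qed.

Let ratios_lbound g : has_lbound (ratios g).
Proof. by exists 0 => _ [x [_ ->]]; exact: bigmax_ge_id. Qed.

(** One test vector bounds the infimum. The sign of [mu] enters because the maximum of the ratios is
    taken together with 0. *)
Lemma cw_radius_lt g mu x : 0 < mu -> posvec x ->
  (forall i, g x i < mu * x i) -> cw_radius g < mu.
Proof.
move=> mu0 x0 gx; apply: (@le_lt_trans _ _ (\big[Num.max/0]_i (g x i / x i))).
  by apply: ge_inf; [exact: ratios_lbound|exists x].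
by apply: bigmax_lt => // i _; rewrite ltr_pdivrMr.
Qed.

Lemma cw_radius_le g mu x : 0 <= mu -> posvec x ->
  (forall i, g x i <= mu * x i) -> cw_radius g <= mu.
Proof.
move=> mu0 x0 gx; apply: (@le_trans _ _ (\big[Num.max/0]_i (g x i / x i))).
  by apply: ge_inf; [exact: ratios_lbound|exists x].
by apply: bigmax_le => // i _; rewrite ler_pdivrMr.
Qed.

Lemma cw_radius_ge g mu :
  (forall x, posvec x -> exists i, mu * x i <= g x i) -> mu <= cw_radius g.
Proof.
move=> H; apply: lb_le_inf; first exact: ratios_neq0.
move=> _ [x [x0 ->]]; have [i Hi] := H x x0.
by apply: (@bigmax_sup _ _ _ _ i) => //; rewrite ler_pdivlMr.
Qed.

Lemma cw_radius_witness g mu : cw_radius g < mu ->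
  exists2 x, posvec x & forall i, g x i < mu * x i.
Proof.
move=> /(inf_lt (ratios_neq0 g))[_ [x [x0 ->]]] H; exists x => // i.
by rewrite -ltr_pdivrMr//; apply: le_lt_trans H; exact: le_bigmax.
Qed.

End CollatzWielandt.

(** * Strongly connected components and final classes *)

Section Classes.
Context {R : realType} {n : nat}.
Variable f : ('I_n -> R) -> ('I_n -> R).
Implicit Types (i j k l : 'I_n) (C T U : {set 'I_n}).
Notation conn := (connect (arcb f)).

Definition arc_closed C : Prop := forall a b, a \in C -> arcb f a b -> b \in C.

Lemma arc_closed_connect C i j : arc_closed C -> i \in C -> conn i j -> j \in C.
Proof.
move=> cC iC /connectP[p pp ->]; elim: p i iC pp => //= k p IH i iC /andP[Dik].
by apply: IH; exact: cC Dik.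
Qed.

Lemma mem_scc i j : (j \in scc f i) = conn i j && conn j i.
Proof. by rewrite inE. Qed.

Lemma scc_id i : i \in scc f i.
Proof. by rewrite mem_scc !connect0. Qed.

Lemma scc_connect i j k : j \in scc f i -> k \in scc f i -> conn j k.
Proof.
rewrite !mem_scc => /andP[_ ji] /andP[ik _].
exact: connect_trans ji ik.
Qed.

Lemma scc_between i j k l : j \in scc f i -> conn j l -> k \in scc f i ->
  conn l k -> l \in scc f i.
Proof.
rewrite !mem_scc => /andP[ij _] jl /andP[_ ki] lk.
by rewrite (connect_trans ij jl) (connect_trans lk ki).
Qed.

Lemma scc_eq i j : j \in scc f i -> scc f j = scc f i.
Proof.
rewrite mem_scc => /andP[ij ji]; apply/setP => k; rewrite !mem_scc.
apply/andP/andP => -[H1 H2]; split.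
- exact: connect_trans ij H1.
- exact: connect_trans H2 ji.
- exact: connect_trans ji H1.
- exact: connect_trans H2 ij.
Qed.

Lemma final_closed C : final_class f C -> arc_closed C.
Proof. by move=> [_ H] a b aC /asboolP; exact: H. Qed.

Lemma closed_final i : arc_closed (scc f i) -> final_class f (scc f i).
Proof. by move=> H; split; [exists i|move=> a b aC /asboolT; exact: H]. Qed.

Lemma final_scc C i : final_class f C -> i \in C -> C = scc f i.
Proof. by move=> [[j ->] _] /scc_eq. Qed.

(** Take [i] in [U] with the fewest reachable vertices: a [j] in [U] reached from [i] with no way
    back would reach strictly fewer, since it misses [i]. *)
Lemma sink_exists U i0 : i0 \in U ->
  exists2 i, i \in U & forall j, j \in U -> conn i j -> conn j i.
Proof.
move=> i0U; case: (@arg_minnP _ i0 (mem U) (fun i => #|conn i|) i0U) => i iU Hi.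
exists i => // j jU ij; apply/negPn/negP => ji.
have := Hi j jU; rewrite leqNgt => /negP; apply.
apply: proper_card; apply/fintype.properP; split.
  by apply/fintype.subsetP => k; rewrite !inE; exact: connect_trans.
by exists i; rewrite !inE// connect0.
Qed.

(** A sink of the set of vertices reachable from [i] is reached back from everything it reaches, so
    no arc leaves its class. *)
Lemma final_reachable i : exists2 j, conn i j & final_class f (scc f j).
Proof.
have [|j] := @sink_exists [set k | conn i k]%SET i.
  by rewrite inE connect0.
rewrite inE => ij Hj; exists j => //; apply: closed_final => a b.
rewrite !mem_scc => /andP[ja aj] Dab.
have jb : conn j b by apply: connect_trans ja _; exact: connect1.
by rewrite jb Hj// inE (connect_trans ij jb).
Qed.

Definition final_set : {set 'I_n} := [set i | `[< final_class f (scc f i) >]]%SET.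

Lemma final_setP i : reflect (final_class f (scc f i)) (i \in final_set).
Proof. by rewrite inE; exact: asboolP. Qed.

Lemma final_set_closed : arc_closed final_set.
Proof.
move=> a b /final_setP fa Dab; apply/final_setP.
by rewrite (scc_eq a)//; apply: final_closed fa _ _ (scc_id a) Dab.
Qed.

End Classes.

(** * Bounds along paths for vectors with [f x <= lam x] *)

Section Eigenvectors.
Context {R : realType} {n : nat}.
Notation vec := ('I_n -> R).
Variable f : vec -> vec.
Hypothesis rf : regular_map f (arcb f).
Implicit Types (x y z u : vec) (C F S T : {set 'I_n}).
Notation conn := (connect (arcb f)).

Let f_ge0 x : nneg x -> nneg (f x).
Proof. by move=> x0 i; exact: (reg_ge0 _ _ (rf i)). Qed.

Let f_gt0 x : posvec x -> posvec (f x).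
Proof. by move=> x0 i; exact: (reg_gt0 _ _ (rf i)). Qed.

Let f_mono x y i : nneg x -> (forall i, x i <= y i) -> f x i <= f y i.
Proof. by move=> x0 xy; exact: (reg_mono _ _ (rf i)). Qed.

Let f_hom c x i : 0 < c -> nneg x -> f (fun j => c * x j) i = c * f x i.
Proof. by move=> c0 x0; exact: (reg_hom _ _ (rf i)). Qed.

Let f_dep x y i : nneg x -> nneg y -> (forall j, arcb f i j -> x j = y j) ->
  f x i = f y i.
Proof. by move=> x0 y0 xy; exact: (reg_dep _ _ (rf i)). Qed.

Let f_dep_pos x y i : posvec x -> posvec y ->
  (forall j, arcb f i j -> x j = y j) -> f x i = f y i.
Proof. by move=> x0 y0; apply: f_dep; exact: posvec_nneg. Qed.

Let f_strict x y i j : posvec x -> (forall i, x i <= y i) -> arcb f i j ->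
  x j < y j -> f x i < f y i.
Proof. by move=> x0 xy Dij; exact: (reg_strict _ _ (rf i) x y j). Qed.

(** Along each arc, a bound on [x i] bounds [f x i] by [lam * B], and coercivity turns this into a
    bound on the next coordinate. *)
Lemma path_bound lam i j : 0 < lam -> conn i j -> forall B, exists A,
  forall x, (forall l, 1 <= x l) ->
    (forall l, conn i l -> f x l <= lam * x l) -> x i <= B -> x j <= A.
Proof.
move=> lam0 /connectP[p pp ->]; elim: p i pp => [|k p IH] i /=.
  by move=> _ B; exists B.
move=> /andP[Dik pp] B.
have [A1 HA1] := reg_coercive _ _ (rf i) k (lam * B) Dik.
have [A HA] := IH k pp A1; exists A => x x1 fx xB; apply: HA => //.
  by move=> l kl; apply: fx; apply: connect_trans kl; exact: connect1.
apply: HA1 => //; apply: le_trans (fx i (connect0 _ _)) _.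
by rewrite ler_pM2l.
Qed.

(** A Harnack-type inequality: [A] is fixed before [C] and [x]. Rescaling so that the minimum over
    [C] equals 1 reduces it to [path_bound]. *)
Lemma super_bound lam : 0 < lam -> exists2 A, 1 <= A &
  forall C x i j, arc_closed f C -> posvec x ->
    (forall l, l \in C -> f x l <= lam * x l) ->
    i \in C -> (forall l, l \in C -> x i <= x l) -> conn i j ->
    x j <= A * x i.
Proof.
move=> lam0.
have [|A A1 HA] := @fin_large R ('I_n * 'I_n)%type (fun ij A =>
  conn ij.1 ij.2 -> forall x, (forall l, 1 <= x l) ->
    (forall l, conn ij.1 l -> f x l <= lam * x l) -> x ij.1 <= 1 ->
    x ij.2 <= A).
  move=> [i j] /=; have [cij|_] := boolP (conn i j); last by exists 0.
  have [A HA] := path_bound lam i j lam0 cij 1.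
  by exists A => A' AA' _ x x1 fx xi; apply: le_trans AA'; exact: HA.
exists A => // C x i j cC x0 fx iC xi cij.
have xi0 : 0 < (x i)^-1 by rewrite invr_gt0.
have jC := arc_closed_connect f C i j cC iC cij.
(* Outside [C] the entries are reset to the minimum [x i], so that all entries are at least 1 after
   scaling; rows in [C] do not see the change because [C] is arc-closed. *)
pose x' l := if l \in C then x l else x i.
have x'0 : posvec x' by move=> l; rewrite /x'; case: ifP.
pose y l := (x i)^-1 * x' l.
suff : y j <= A by rewrite /y /x' jC ler_pdivrMl// mulrC.
apply: (HA (i, j)) => //=.
- by move=> l; rewrite /y /x' ler_pdivlMl// mulr1; case: ifP => // /xi.
- move=> l cil; have lC := arc_closed_connect f C i l cC iC cil.
  rewrite /y f_hom//; last exact: posvec_nneg.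
  rewrite mulrCA ler_pM2l// (f_dep _ x).
  + by rewrite /x' lC fx.
  + exact: posvec_nneg.
  + exact: posvec_nneg.
  + by move=> k Dlk; rewrite /x' (cC l).
- by rewrite /y /x' iC mulVf// gt_eqF.
Qed.

(** * Restriction to a class, spread of strictness, and eigenvectors on final classes *)

Lemma argmin_set C x : (exists i, i \in C) ->
  exists2 i, i \in C & forall l, l \in C -> x i <= x l.
Proof.
by move=> [i0 i0C]; case: (arg_minP x i0C) => i iC xi; exists i.
Qed.

Lemma PJ0_nneg C x : nneg x -> nneg (PJ0 C x).
Proof. by move=> x0 i; rewrite /PJ0; case: ifP. Qed.

Lemma PJ0_le C x y : (forall i, x i <= y i) -> forall i, PJ0 C x i <= PJ0 C y i.
Proof. by move=> xy i; rewrite /PJ0; case: ifP. Qed.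

Lemma PJ0_dep C x i : nneg x -> (forall j, arcb f i j -> j \in C) ->
  f (PJ0 C x) i = f x i.
Proof.
move=> x0 H; apply: f_dep => //; first exact: PJ0_nneg.
by move=> j /H jC; rewrite /PJ0 jC.
Qed.

Lemma fJ0_in C x i : i \in C -> fJ0 C f x i = f (PJ0 C x) i.
Proof. by rewrite /fJ0 {1}/PJ0 => ->. Qed.

Lemma fJ0_out C x i : i \notin C -> fJ0 C f x i = 0.
Proof. by rewrite /fJ0 {1}/PJ0 => /negbTE ->. Qed.

(* Shrinking [z] slightly on a set [S] of strict inequalities keeps them strict
   and makes the inequality strict at every [i] with an arc into [S]; hence
   strictness propagates backwards along arcs. *)
Lemma strict_spread_step mu C S z i1 j1 : 0 < mu -> S \subset C -> posvec z ->
  (forall i, i \in S -> f (PJ0 C z) i < mu * z i) ->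
  (forall i, i \in C -> i \notin S ->
     f (PJ0 C z) i <= mu * z i /\ forall j, arcb f i j -> j \in C) ->
  i1 \in C -> i1 \notin S -> j1 \in S -> arcb f i1 j1 ->
  exists2 z', posvec z' &
    (forall i, i \in i1 |: S -> f (PJ0 C z') i < mu * z' i) /\
    (forall i, i \in C -> i \notin i1 |: S ->
     f (PJ0 C z') i <= mu * z' i /\ forall j, arcb f i j -> j \in C).
Proof.
move=> mu0 SC z0 Ss Sw i1C i1S j1S Dij.
have [|d d0 Hd] := @fin_small R 'I_n (fun i d => d < 1 /\
    (i \in S -> f (PJ0 C z) i < mu * ((1 - d) * z i))).
  move=> i; have [iS|iS] := boolP (i \in S); last first.
    by exists (1 / 2) => [|d /andP[d0 d1]]; [lra|split => //; lra].
  (* Half of the relative gap of row [i]: shrinking [z i] by a factor [1 - d] with [d <= e] keeps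
     the row strict. *)
  pose e := (mu * z i - f (PJ0 C z) i) / (mu * z i) / 2.
  have muz0 : 0 < mu * z i by rewrite mulr_gt0.
  have sl : 0 < mu * z i - f (PJ0 C z) i by rewrite subr_gt0 Ss.
  have fz0 : 0 <= f (PJ0 C z) i.
    exact/f_ge0/PJ0_nneg/posvec_nneg.
  have e0 : 0 < e by rewrite /e !divr_gt0.
  have eE : e * (mu * z i) = (mu * z i - f (PJ0 C z) i) / 2.
    by rewrite /e mulrAC divfK ?gt_eqF.
  exists e => // d /andP[d0 de]; split.
    apply: le_lt_trans de _; rewrite -(ltr_pM2r muz0) eE; lra.
  move=> _; have := ler_wpM2r (ltW muz0) de; rewrite eE.
  have -> : mu * ((1 - d) * z i) = mu * z i - d * (mu * z i) by ring.
  lra.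
have d1 : d < 1 := (Hd i1).1.
pose z' l := if l \in S then (1 - d) * z l else z l.
have z'0 : posvec z'.
  by move=> l; rewrite /z'; case: ifP => // _; rewrite mulr_gt0// subr_gt0.
have z'z l : z' l <= z l.
  rewrite /z'; case: ifP => // _; have := z0 l => zl.
  by rewrite mulrBl mul1r gerBl mulr_ge0 ?ltW.
have fz'z l : f (PJ0 C z') l <= f (PJ0 C z) l.
  by apply: f_mono; [exact/PJ0_nneg/posvec_nneg|exact: PJ0_le].
exists z' => //; split.
- move=> i; rewrite in_setU1 => /orP[/eqP ->|iS].
    have [H1 H2] := Sw _ i1C i1S.
    rewrite {2}/z' (negbTE i1S); apply: lt_le_trans H1.
    rewrite !PJ0_dep//; [|exact: posvec_nneg|exact: posvec_nneg].
    apply: f_strict Dij _ => //.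
    by rewrite /z' j1S mulrBl mul1r gtrBl mulr_gt0.
  by apply: le_lt_trans (fz'z i) _; rewrite /z' iS; exact: (Hd i).2.
- move=> i iC; rewrite in_setU1 negb_or => /andP[_ iS].
  have [H1 H2] := Sw _ iC iS; split => //.
  by apply: le_trans (fz'z i) _; rewrite /z' (negbTE iS).
Qed.

(** Induction on the number of rows of [C] not yet strict: a path in [C] to [i0] must enter the
    strict set by some arc, and its source is added. Strict monotonicity is available on positive
    vectors only, so a row that is not strict at the start must have all its arcs in [C], where it
    does not see the zeros of [PJ0]. *)
Lemma strict_spread mu C x : 0 < mu ->
  (forall i j, i \in C -> j \in C -> conn i j) ->
  (forall i j l, i \in C -> conn i l -> j \in C -> conn l j ->
     l \in C) ->
  posvec x ->
  (forall i, i \in C -> f (PJ0 C x) i < mu * x i \/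
     (f (PJ0 C x) i <= mu * x i /\ forall j, arcb f i j -> j \in C)) ->
  (exists2 i, i \in C & f (PJ0 C x) i < mu * x i) ->
  exists2 z, posvec z & forall i, i \in C -> f (PJ0 C z) i < mu * z i.
Proof.
move=> mu0 Cc Cs x0 xC [i0 i0C xi0].
suff H : forall m S z, (#|C :\: S| <= m)%N -> S \subset C -> i0 \in S ->
    posvec z -> (forall i, i \in S -> f (PJ0 C z) i < mu * z i) ->
    (forall i, i \in C -> i \notin S ->
     f (PJ0 C z) i <= mu * z i /\ forall j, arcb f i j -> j \in C) ->
    exists2 z, posvec z & forall i, i \in C -> f (PJ0 C z) i < mu * z i.
  pose S : {set 'I_n} := [set i in C | f (PJ0 C x) i < mu * x i]%SET.
  apply: (H #|C :\: S| S x) => //.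
  - by apply/fintype.subsetP => i; rewrite inE => /andP[].
  - by rewrite inE i0C.
  - by move=> i; rewrite inE => /andP[].
  - by move=> i iC; rewrite inE iC/=; case: (xC i iC) => [->|].
elim=> [|m IH] S z Sm SC i0S z0 Ss Sw.
  exists z => // i iC; apply: Ss; apply/negPn/negP => iS.
  move: Sm; rewrite leqn0 cards_eq0 => /eqP/setP/(_ i).
  by rewrite !inE iC iS.
have [CS|] := boolP (C \subset S).
  by exists z => // i iC; apply: Ss; exact: (fintype.subsetP CS).
move=> /fintype.subsetPn[a aC aS].
have [i1 [j1 [i1C i1S j1S Dij]]] : exists i j, [/\ i \in C, i \notin S, j \in S & arcb f i j].
  have /connectP[p pp pl] := Cc a i0 aC i0C.
  elim: p a aC aS pp pl => [|b p IHp] a aC aS /=.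
    by move=> _ E; rewrite -E i0S in aS.
  move=> /andP[Dab pb] pl; have [bS|bS] := boolP (b \in S).
    by exists a, b.
  apply: (IHp b) => //; apply: (Cs a i0) => //; first exact: connect1.
  by apply/connectP; exists p.
have [z' z'0 [H1 H2]] :=
  strict_spread_step mu C S z i1 j1 mu0 SC z0 Ss Sw i1C i1S j1S Dij.
apply: (IH (i1 |: S) z') => //.
- have : (#|C :\: (i1 |: S)| < #|C :\: S|)%N.
    apply: proper_card; apply/fintype.properP; split.
      by apply/finset.setDS/finset.subsetUr.
    by exists i1; rewrite !inE ?i1C ?i1S// eqxx.
  by move=> H; rewrite -ltnS; apply: leq_trans H Sm.
- by rewrite finset.subUset finset.sub1set i1C.
- by rewrite in_setU1 i0S orbT.
Qed.

(** This is attainment of the infimum in the radius. Monotone limits and homogeneity replace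
    compactness and continuity. *)
Lemma super_limit C k mu : arc_closed f C -> k \in C ->
  (forall i j, i \in C -> j \in C -> conn i j) -> 0 < mu ->
  (forall lam, mu < lam -> exists2 x, posvec x &
     forall i, i \in C -> f x i <= lam * x i) ->
  exists2 u, posvec u & forall i, i \in C -> f u i <= mu * u i.
Proof.
move=> cC kC Cc mu0 Hlam.
have [|A A1 HA] := super_bound (mu + 1); first lra.
have A0 : 0 < A by lra.
(* With this normalisation, [super_bound] confines all candidates for [lam <= mu + 1] to the
   interval from [A^-1] to [A]. *)
pose S lam x := [/\ posvec x, x k = 1, forall i, i \notin C -> x i = 1 &
  forall i, i \in C -> f x i <= lam * x i].
have Smono lam lam' x : lam <= lam' -> S lam x -> S lam' x.
  move=> ll' [x0 xk xC fx]; split => // i iC; apply: le_trans (fx i iC) _.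
  by rewrite ler_wpM2r// ltW.
have Sbound lam x i : lam <= mu + 1 -> S lam x -> A^-1 <= x i <= A.
  move=> lmu /(Smono _ _ _ lmu)[x0 xk xC fx].
  have [iC|iC] := boolP (i \in C); last first.
    by rewrite xC// A1 andbT invf_le1.
  have [m mC xm] := argmin_set C x (ex_intro _ k kC).
  have Hm j : j \in C -> x j <= A * x m.
    by move=> jC; apply: (HA C) => //; exact: Cc.
  apply/andP; split.
    apply: le_trans (xm i iC); rewrite -[leLHS]mulr1 ler_pdivrMl//.
    by rewrite -xk; exact: Hm.
  apply: le_trans (Hm i iC) _; rewrite ger_pMr// -xk; exact: xm.
have Sex lam : mu < lam -> exists x, S lam x.
  move=> /Hlam[x x0 fx]; pose y i := (x k)^-1 * x i.
  have xk0 : 0 < (x k)^-1 by rewrite invr_gt0.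
  have y0 : posvec y by move=> i; rewrite mulr_gt0.
  pose y' i := if i \in C then y i else 1.
  have y'0 : posvec y' by move=> i; rewrite /y'; case: ifP.
  exists y'; split => //.
  - by rewrite /y' kC /y mulVf// gt_eqF.
  - by move=> i iC; rewrite /y' (negbTE iC).
  - move=> i iC; rewrite {2}/y' iC.
    rewrite (f_dep_pos _ y)//; last by move=> j Dij; rewrite /y' (cC i j).
    rewrite f_hom//; last exact: posvec_nneg.
    by rewrite mulrCA ler_pM2l// fx.
(* By monotonicity of [f] the pointwise infimum again satisfies the inequality on [C]. It grows as
   [lam] decreases to [mu], and [u] below is its limit. *)
pose v lam i := inf [set y | exists x, S lam x /\ y = x i]%classic.
have vle lam x i : lam <= mu + 1 -> S lam x -> v lam i <= x i.
  move=> lmu Sx; apply: ge_inf; last by exists x.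
  by exists A^-1 => _ [y [Sy ->]]; have /andP[] := Sbound _ _ i lmu Sy.
have vge lam i a : mu < lam -> (forall x, S lam x -> a <= x i) -> a <= v lam i.
  move=> lmu Ha; apply: lb_le_inf; last by move=> _ [y [Sy ->]]; exact: Ha.
  by have [x Sx] := Sex _ lmu; exists (x i), x.
have v0 lam : mu < lam -> lam <= mu + 1 -> posvec (v lam).
  move=> l1 l2 i; apply: (@lt_le_trans _ _ A^-1); first by rewrite invr_gt0.
  by apply: vge => // x Sx; have /andP[] := Sbound _ _ i l2 Sx.
have vA lam i : mu < lam -> lam <= mu + 1 -> v lam i <= A.
  move=> l1 l2; have [x Sx] := Sex _ l1.
  by apply: le_trans (vle _ _ i l2 Sx) _; have /andP[] := Sbound _ _ i l2 Sx.
have fv lam i : mu < lam -> lam <= mu + 1 -> i \in C ->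
    f (v lam) i <= lam * v lam i.
  move=> l1 l2 iC; have lam0 : 0 < lam by lra.
  rewrite -ler_pdivrMl//; apply: vge => // x Sx; rewrite ler_pdivrMl//.
  have [x0 _ _ fx] := Sx; apply: le_trans (fx i iC).
  by apply: f_mono; [exact/posvec_nneg/v0|move=> j; exact: vle].
have vanti lam lam' i : mu < lam -> lam <= lam' -> lam' <= mu + 1 ->
    v lam' i <= v lam i.
  by move=> l1 l2 l3; apply: vge => // x Sx; apply: vle => //; exact: Smono Sx.
pose V i : set R := [set y | exists lam, [/\ mu < lam, lam <= mu + 1 & y = v lam i]]%classic.
pose u i := sup (V i).
have V0 i : (V i !=set0)%classic.
  by exists (v (mu + 1) i), (mu + 1); split => //; lra.
have uge lam i : mu < lam -> lam <= mu + 1 -> v lam i <= u i.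
  move=> l1 l2; apply: ub_le_sup; last by exists lam.
  by exists A => _ [l [l3 l4 ->]]; exact: vA.
have u0 : posvec u.
  move=> i; apply: (@lt_le_trans _ _ (v (mu + 1) i)); first by apply: v0; lra.
  by apply: uge; lra.
exists u => // i iC.
(* For [d] small, [u <= (1 + e) * v (mu + d)] in every coordinate, so homogeneity carries the
   inequality from [v] to [u] with an error that vanishes with [e]. *)
suff H e : 0 < e -> e <= 1 -> f u i <= (1 + e) * ((mu + e) * u i).
  rewrite leNgt; apply/negP => g0.
  (* For [e <= 1] the right-hand side of [H] exceeds [mu * u i] by at most [e * w]; [e] is chosen to
     make this at most half of the gap [g]. *)
  pose g := f u i - mu * u i; pose w := (mu + 2) * u i.
  have w0 : 0 < w by rewrite /w mulr_gt0//; lra.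
  have gg : 0 < g by rewrite /g subr_gt0.
  pose e := Num.min 1 (g / w / 2).
  have e0 : 0 < e by rewrite /e lt_min ltr01 !divr_gt0.
  have e1 : e <= 1 by rewrite /e ge_min lexx.
  have ew : e * w <= g / 2.
    have : e <= g / w / 2 by rewrite /e ge_min lexx orbT.
    by move=> /(ler_wpM2r (ltW w0)); rewrite (mulrAC _ 2^-1) divfK ?gt_eqF.
  have := H e e0 e1.
  have : e * e * u i <= e * u i.
    by rewrite ler_wpM2r ?ger_pMr// ltW.
  rewrite (_ : (1 + e) * ((mu + e) * u i) =
    mu * u i + e * (mu * u i) + e * u i + e * e * u i); last by ring.
  have : e * w = e * (mu * u i) + 2 * (e * u i) by rewrite /w; ring.
  move: ew gg; rewrite /g; lra.
move=> e0 e1.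
have [|d d0 Hd] := @fin_small R 'I_n
    (fun j d => d <= e /\ u j <= (1 + e) * v (mu + d) j).
  move=> j; have uj : u j / (1 + e) < u j.
    by rewrite ltr_pdivrMr; [rewrite mulrDr mulr1 ltrDl mulr_gt0|lra].
  have [_ [lam [l1 l2 ->]] Hl] := sup_gt (V0 j) uj.
  exists (Num.min e (lam - mu)); first by rewrite lt_min e0 subr_gt0.
  move=> d /andP[d0]; rewrite le_min => /andP[de dl]; split => //.
  move: Hl; rewrite ltr_pdivrMr; last lra.
  move=> /ltW Hl; apply: le_trans Hl _; rewrite mulrC ler_wpM2l//; first lra.
  by apply: vanti; lra.
have [de _] := Hd i; have l1 : mu < mu + d by lra.
have l2 : mu + d <= mu + 1 by lra.
have vp := v0 _ l1 l2.
apply: (@le_trans _ _ ((1 + e) * f (v (mu + d)) i)).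
  rewrite -f_hom; [|lra|exact: posvec_nneg].
  by apply: f_mono; [exact: posvec_nneg|move=> j; exact: (Hd j).2].
rewrite ler_wpM2l//; first lra.
apply: le_trans (fv _ _ l1 l2 iC) _; apply: ler_pM => //.
- lra.
- exact: ltW.
- by rewrite lerD2l.
- exact: uge.
Qed.

(** If the vector from [super_limit] were strict in one row of [C], [strict_spread] would make all
    rows of [C] strict and push the radius below [mu]. *)
Lemma final_eigenvector C mu : final_class f C -> 0 < mu ->
  cw_radius (fJ0 C f) = mu ->
  exists2 u, posvec u & forall i, i \in C -> f u i = mu * u i.
Proof.
move=> fC mu0 cwC; have cC := final_closed f C fC.
have [k Ck] : exists k, C = scc f k by case: fC.
have kC : k \in C by rewrite Ck scc_id.
have Cc i j : i \in C -> j \in C -> conn i j by rewrite Ck; exact: scc_connect.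
have PC x i : posvec x -> i \in C -> f (PJ0 C x) i = f x i.
  move=> x0 iC; apply: (PJ0_dep) => //; first exact: posvec_nneg.
  by move=> j; exact: cC.
have [lam|u u0 fu] := super_limit C k mu cC kC Cc mu0.
  rewrite -cwC => /cw_radius_witness[x x0 fx]; exists x => // i iC.
  by have := fx i; rewrite fJ0_in// PC// => /ltW.
exists u => // i iC; apply/eqP; rewrite eq_le fu//= leNgt; apply/negP => fui.
have [||i' iC'||z z0 fz] := strict_spread mu C u mu0 Cc.
- by move=> a b l; rewrite Ck => aC al bC lb; exact: scc_between aC al bC lb.
- exact: u0.
- by right; split; [rewrite PC// fu|move=> j; exact: cC].
- by exists i => //; rewrite PC.
have : cw_radius (fJ0 C f) < mu.
  apply: (cw_radius_lt _ _ z) => // l; have [lC|lC] := boolP (l \in C).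
    by rewrite fJ0_in// fz.
  by rewrite fJ0_out// mulr_gt0.
by rewrite cwC ltxx.
Qed.

(** The inequality is built up on growing arc-closed sets [T]. Rows of [T] do not see the
    coordinates of a newly added class, so what is already achieved persists. *)
Lemma super_extend mu F z : 0 < mu -> arc_closed f F -> posvec z ->
  (forall i, i \in F -> f z i <= mu * z i) ->
  (forall i, i \notin F -> cw_radius (fJ0 (scc f i) f) < mu) ->
  exists x, [/\ posvec x, forall i, i \in F -> x i = z i &
    forall i, f x i <= mu * x i].
Proof.
move=> mu0 cF z0 fz cwF.
suff H m T x : (#|~: T| <= m)%N -> F \subset T -> arc_closed f T ->
    posvec x -> (forall i, i \in F -> x i = z i) ->
    (forall i, i \in T -> f x i <= mu * x i) ->
    exists x, [/\ posvec x, forall i, i \in F -> x i = z i &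
      forall i, f x i <= mu * x i].
  exact: (H #|~: F| F z).
elim: m T x => [|m IH] T x Tm FT cT x0 xF fx.
  exists x; split => // i; apply: fx; move: Tm.
  rewrite leqn0 cards_eq0 => /eqP/setP/(_ i).
  by rewrite !inE => /negbFE.
have [/eqP/setP TT|] := boolP (~: T == finset.set0).
  by exists x; split => // i; apply: fx; move: (TT i); rewrite !inE => /negbFE.
(* A sink of the complement is chosen so that arcs from its class [C] lead only into [C] or [T]. *)
move=> /set0Pn[i0 i0T]; have [i iT Hi] := sink_exists f _ i0 i0T.
have {}Hi j : j \notin T -> conn i j -> conn j i.
  by move=> jT; apply: Hi; rewrite inE.
rewrite inE in iT; pose C := scc f i.
have CT j : j \in C -> j \notin T.
  rewrite mem_scc => /andP[_ ji]; apply: contra iT => jT.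
  exact: (arc_closed_connect _ _ _ _ cT jT ji).
have Cout a b : a \in C -> arcb f a b -> b \in C \/ b \in T.
  move=> aC Dab; have [bT|bT] := boolP (b \in T); [by right|left].
  move: aC; rewrite !mem_scc => /andP[ia _].
  have ib : conn i b by apply: connect_trans ia _; exact: connect1.
  by rewrite ib Hi.
have iF : i \notin F by apply: contra iT; exact: fintype.subsetP.
have [y y0 fy] := cw_radius_witness _ _ (cwF i iF).
(* The strict inequality for [y] leaves room to raise every coordinate of [PJ0 C y] by [d]. Once
   [K * d] dominates [x], the old values outside [C] are absorbed by this margin. *)
have [|d d0 Hd] := @fin_small R 'I_n (fun l d => l \in C ->
    f (fun j => PJ0 C y j + d) l <= mu * y l).
  move=> l; have [lC|_] := boolP (l \in C); last by exists 1.
  have Py := PJ0_nneg C y (posvec_nneg _ y0).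
  have [|d d0 Hd] := reg_usc _ _ (rf l) (PJ0 C y) (mu * y l) Py.
    by have := fy l; rewrite fJ0_in.
  exists d => // d' /andP[d'0 d'd] _; apply: le_trans Hd.
  by apply: f_mono; [exact/nnegD/ltW|move=> j; rewrite lerD2l].
have [|K K1 HK] := @fin_large R 'I_n (fun l K => x l <= K * d).
  by move=> l; exists (x l / d) => K; rewrite ler_pdivrMr.
have K0 : 0 < K by lra.
pose x' j := if j \in C then K * y j else x j.
have x'0 : posvec x' by move=> j; rewrite /x'; case: ifP => // _; rewrite mulr_gt0.
have Pd : nneg (fun j => PJ0 C y j + d).
  by apply: nnegD; [exact/PJ0_nneg/posvec_nneg|exact: ltW].
have fx'C l : l \in C -> f x' l <= mu * x' l.
  move=> lC; apply: (@le_trans _ _ (K * f (fun j => PJ0 C y j + d) l)).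
    rewrite -f_hom//; apply: f_mono; first exact: posvec_nneg.
    move=> j; rewrite /x' /PJ0; case: ifP => _.
      by rewrite ler_pM2l// lerDl ltW.
    by rewrite add0r.
  by rewrite /x' lC mulrCA ler_pM2l// Hd.
have fx'T l : l \in T -> f x' l <= mu * x' l.
  move=> lT; have lC : l \notin C by apply: contraL lT; exact: CT.
  rewrite {2}/x' (negbTE lC) (f_dep_pos _ x) ?fx// => j Dlj.
  have jT := cT _ _ lT Dlj; rewrite /x' ifN//.
  by apply: contraL jT; exact: CT.
apply: (IH (T :|: C) x') => //.
- rewrite -ltnS; apply: leq_trans Tm; apply: proper_card.
  apply/fintype.properP; split.
    by rewrite finset.setCS finset.subsetUl.
  by exists i; rewrite !inE ?iT// !connect0 orbT.
- exact: fintype.subset_trans FT (finset.subsetUl _ _).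
- move=> a b; rewrite !finset.in_setU => /orP[aT|aC] Dab.
    by rewrite (cT a b).
  by case: (Cout _ _ aC Dab) => ->//; rewrite orbT.
- move=> j jF; rewrite /x' ifN ?xF//.
  by apply: contraL (fintype.subsetP FT j jF); exact: CT.
- by move=> l; rewrite finset.in_setU => /orP[/fx'T|/fx'C].
Qed.

Lemma super_to_eigen mu F z x : 0 < mu -> arc_closed f F ->
  (forall i, exists2 j, j \in F & conn i j) -> posvec z ->
  (forall i, i \in F -> f z i = mu * z i) ->
  posvec x -> (forall i, i \in F -> x i = z i) ->
  (forall i, f x i <= mu * x i) ->
  exists y, [/\ posvec y, forall i, i \in F -> y i = z i &
    forall i, f y i = mu * y i].
Proof.
move=> mu0 cF toF z0 fz x0 xF fx.
pose S x := [/\ posvec x, forall i, i \in F -> x i = z i &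
  forall i, f x i <= mu * x i].
have Sx : S x by [].
have [A A1 HA] := super_bound mu mu0.
have A0 : 0 < A by lra.
have [a a0 Ha] : exists2 a, 0 < a & forall i, a <= z i / A.
  by apply: fin_small => i; exists (z i / A) => [|d /andP[]//]; rewrite divr_gt0.
(* The smallest coordinate of [y] has a path to [F], where [y] agrees with [z]; [super_bound] then
   keeps the infimum over [S] positive. *)
have Slow y i : S y -> a <= y i.
  move=> [y0 yF fy].
  have [m _ ym] := argmin_set [set: 'I_n]%SET y (ex_intro _ i (finset.in_setT i)).
  apply: le_trans (ym i (finset.in_setT i)); have [j jF mj] := toF m.
  apply: le_trans (Ha j) _; rewrite ler_pdivrMr// mulrC -yF//.
  have cT : arc_closed f [set: 'I_n]%SET by move=> *; exact: finset.in_setT.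
  exact: (HA _ y m j cT y0 (fun l _ => fy l) (finset.in_setT _) ym mj).
pose w i := inf [set t | exists y, S y /\ t = y i]%classic.
have wle y i : S y -> w i <= y i.
  move=> Sy; apply: ge_inf; last by exists y.
  by exists a => _ [y' [Sy' ->]]; exact: Slow.
have wge b i : (forall y, S y -> b <= y i) -> b <= w i.
  move=> Hb; apply: lb_le_inf; last by move=> _ [y [Sy ->]]; exact: Hb.
  by exists (x i), x.
have w0 : posvec w.
  by move=> i; apply: lt_le_trans a0 _; apply: wge => y; exact: Slow.
have wF i : i \in F -> w i = z i.
  move=> iF; apply/eqP; rewrite eq_le -{1}(xF i iF) wle//=.
  by apply: wge => y [_ yF _]; rewrite yF.
have fw i : f w i <= mu * w i.
  rewrite -ler_pdivrMl//; apply: wge => y Sy; rewrite ler_pdivrMl//.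
  have [_ _ fy] := Sy; apply: le_trans (fy i).
  by apply: f_mono; [exact: posvec_nneg|move=> j; exact: wle].
exists w; split => // i; apply/eqP; rewrite eq_le fw/=.
have muV : 0 < mu^-1 by rewrite invr_gt0.
(* The Knaster-Tarski step: [w'] belongs to [S], so minimality gives [w <= w'], the missing
   inequality. *)
pose w' j := mu^-1 * f w j.
have w'w j : w' j <= w j by rewrite /w' ler_pdivrMl.
have w'0 : posvec w' by move=> j; rewrite mulr_gt0// f_gt0.
suff Sw' : S w' by have := wle w' i Sw'; rewrite /w' ler_pdivlMl.
split => // j.
- move=> jF; rewrite /w' (f_dep_pos _ z) ?fz ?mulKf ?gt_eqF// => l Djl.
  by rewrite wF// (cF j l).
- rewrite {2}/w' mulVKf ?gt_eqF//.
  by apply: f_mono => //; exact: posvec_nneg.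
Qed.

(** * Radii of the restrictions of a map that has a positive eigenvector *)

Lemma PJ0_closed C x i : arc_closed f C -> posvec x -> i \in C ->
  f (PJ0 C x) i = f x i.
Proof.
move=> cC x0 iC; apply: (PJ0_dep); first exact: posvec_nneg.
by move=> j; exact: cC.
Qed.

Lemma arc_closed_setT : arc_closed f [set: 'I_n]%SET.
Proof. by move=> *; exact: finset.in_setT. Qed.

Lemma fJ0_setT : fJ0 [set: 'I_n]%SET f = f.
Proof.
apply/funext => x; apply/funext => i; rewrite fJ0_in ?finset.in_setT//.
by congr f; apply/funext => j; rewrite /PJ0 finset.in_setT.
Qed.

(** The vector [x] itself gives the upper bound. For the lower bound, any [y] is compared with the
    largest multiple of [x] below it on [C]: the row where the two touch has ratio at least [mu]. *)
Lemma cw_radius_closed C k mu x : arc_closed f C -> k \in C -> 0 < mu ->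
  posvec x -> (forall i, i \in C -> f x i = mu * x i) ->
  cw_radius (fJ0 C f) = mu.
Proof.
move=> cC kC mu0 x0 fx; apply/eqP; rewrite eq_le; apply/andP; split.
  apply: (cw_radius_le _ _ x) => //; first exact: ltW.
  move=> i; have [iC|iC] := boolP (i \in C).
    by rewrite fJ0_in// PJ0_closed// fx.
  by rewrite fJ0_out// mulr_ge0// ltW.
apply: cw_radius_ge => y y0.
have [i iC Hi] := argmin_set C (fun i => y i / x i) (ex_intro _ k kC).
exists i; rewrite fJ0_in//; set c := y i / x i in Hi.
have c0 : 0 < c by rewrite divr_gt0.
have yi : y i = c * x i by rewrite /c divfK// gt_eqF.
have cx0 : posvec (fun j => c * x j) by move=> j; rewrite mulr_gt0.
rewrite yi mulrCA -fx// -f_hom//; last exact: posvec_nneg.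
rewrite -(PJ0_closed _ _ _ cC cx0 iC); apply: f_mono.
  exact/PJ0_nneg/posvec_nneg.
move=> j; rewrite /PJ0; case: ifP => // jC.
by rewrite -ler_pdivlMr// Hi.
Qed.

(** In the row of the smallest coordinate [x i], [f x] is at least [x i] times its value at the
    all-ones vector. *)
Lemma cw_radius_gt0 : (0 < n)%N -> 0 < cw_radius f.
Proof.
move=> n0.
have [a a0 Ha] : exists2 a, 0 < a & forall i, a <= f (fun=> 1) i.
  apply: fin_small => i; exists (f (fun=> 1) i); last by move=> d /andP[].
  by apply: f_gt0 => ?; exact: ltr01.
apply: (lt_le_trans a0); apply: cw_radius_ge => x x0.
have [i _ xi] := argmin_set [set: 'I_n]%SET x
  (ex_intro _ (Ordinal n0) (finset.in_setT _)).
exists i; rewrite mulrC; apply: (@le_trans _ _ (x i * f (fun=> 1) i)).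
  by rewrite ler_pM2l.
rewrite -f_hom//; apply: f_mono; first by move=> j; rewrite mulr1 ltW.
by move=> j; rewrite mulr1 xi// finset.in_setT.
Qed.

Lemma cw_radius_nonfinal i mu x : 0 < mu -> posvec x ->
  (forall j, f x j = mu * x j) -> ~ final_class f (scc f i) ->
  cw_radius (fJ0 (scc f i) f) < mu.
Proof.
move=> mu0 x0 fx nfin; set C := scc f i.
have exit l j : arcb f l j -> j \notin C -> f (PJ0 C x) l < mu * x l.
  (* Strict monotonicity needs positive vectors, so the lost coordinate is halved instead of zeroed;
     [x'] lies between [PJ0 C x] and [x]. *)
  move=> Dlj jC; pose x' k := if k == j then x k / 2 else x k.
  have x'0 : posvec x'.
    by move=> k; rewrite /x'; case: ifP => // _; rewrite divr_gt0.
  have half k : x k / 2 < x k by have := x0 k; lra.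
  apply: (@le_lt_trans _ _ (f x' l)).
    apply: f_mono; first exact/PJ0_nneg/posvec_nneg.
    move=> k; rewrite /PJ0 /x'; have [->|kj] := eqVneq k j.
      by rewrite (negbTE jC) ltW// divr_gt0.
    by case: ifP => // _; exact: ltW.
  rewrite -fx; apply: f_strict Dlj _ => //; last by rewrite /x' eqxx.
  by move=> k; rewrite /x'; case: ifP => // _; exact: ltW.
have [|||l lC||z z0 fz] := strict_spread mu C x mu0.
- by move=> a b; exact: scc_connect.
- by move=> a b l aC al bC; exact: (scc_between _ _ _ _ _ aC al bC).
- exact: x0.
- have [/forallP Hl|] := boolP [forall j, arcb f l j ==> (j \in C)].
    have {}Hl j : arcb f l j -> j \in C by exact/implyP.
    right; split => //.
    by rewrite (PJ0_dep) ?fx//; exact: posvec_nneg.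
  rewrite negb_forall => /existsP[j]; rewrite negb_imply => /andP[Dlj jC].
  by left; exact: exit jC.
- apply: contra_notP nfin => Hn; apply: closed_final => a b aC Dab.
  apply/negPn/negP => bC; apply: Hn; exists a => //; exact: exit bC.
apply: (cw_radius_lt _ _ z) => // l; have [lC|lC] := boolP (l \in C).
  by rewrite fJ0_in// fz.
by rewrite fJ0_out// mulr_gt0.
Qed.

(** * Positive eigenvectors on the whole graph: existence and uniqueness *)

Lemma eigen_extend mu z : 0 < mu -> posvec z ->
  (forall i, i \in final_set f -> f z i = mu * z i) ->
  (forall i, i \notin final_set f -> cw_radius (fJ0 (scc f i) f) < mu) ->
  exists y, [/\ posvec y, forall i, i \in final_set f -> y i = z i &
    forall i, f y i = mu * y i].
Proof.
move=> mu0 z0 fz cwF; have cF := final_set_closed f.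
have [|x [x0 xF fx]] := super_extend mu _ z mu0 cF z0 _ cwF.
  by move=> i iF; rewrite fz.
apply: (super_to_eigen mu _ z x) => // i.
by have [j ij jf] := final_reachable f i; exists j => //; exact/final_setP.
Qed.

(** If [y] touches [c * x] at [a] and exceeds it at [b], an arc from [a] to [b] makes row [a] of [f]
    strictly larger at [y], although both values equal [mu * (c * x a)]. *)
Lemma ratio_closed mu c x y : 0 < mu -> 0 < c -> posvec x -> posvec y ->
  (forall i, f x i = mu * x i) -> (forall i, f y i = mu * y i) ->
  (forall i, c * x i <= y i) ->
  arc_closed f [set i | y i == c * x i]%SET.
Proof.
move=> mu0 c0 x0 y0 fx fy cxy a b + Dab; rewrite !inE => /eqP ya.
rewrite eq_le cxy andbT leNgt; apply/negP => H.
have cx0 : posvec (fun j => c * x j) by move=> j; rewrite mulr_gt0.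
have := f_strict _ _ _ _ cx0 cxy Dab H.
rewrite f_hom//; last exact: posvec_nneg.
by rewrite fx fy ya mulrCA ltxx.
Qed.

Lemma min_ratio mu C x y : (0 < n)%N -> 0 < mu -> posvec x -> posvec y ->
  (forall i, f x i = mu * x i) -> (forall i, f y i = mu * y i) ->
  (forall D, final_class f D -> D = C) ->
  exists2 c, 0 < c & (forall i, c * x i <= y i) /\
    forall i, i \in C -> y i = c * x i.
Proof.
move=> n0 mu0 x0 y0 fx fy uC.
have [i _ Hi] := argmin_set [set: 'I_n]%SET (fun i => y i / x i)
  (ex_intro _ (Ordinal n0) (finset.in_setT _)).
set c := y i / x i in Hi; have c0 : 0 < c by rewrite divr_gt0.
have cxy j : c * x j <= y j by rewrite -ler_pdivlMr// Hi// finset.in_setT.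
exists c => //; split => // k kC.
have cl := ratio_closed mu c x y mu0 c0 x0 y0 fx fy cxy.
have [j ij jf] := final_reachable f i.
have jS : j \in [set i | y i == c * x i]%SET.
  by apply: (arc_closed_connect _ _ _ _ cl _ ij); rewrite inE /c divfK// gt_eqF.
have jk : conn j k.
  by move: kC; rewrite -(uC _ jf) mem_scc => /andP[].
by have := arc_closed_connect _ _ _ _ cl jS jk; rewrite inE => /eqP.
Qed.

(** Both minimal ratios, of [y] to [x] and of [x] to [y], are attained on all of [C]. Hence they are
    inverse to each other, and the two inequalities become equalities. *)
Lemma eigen_unique mu C x y : (0 < n)%N -> 0 < mu -> posvec x -> posvec y ->
  (forall i, f x i = mu * x i) -> (forall i, f y i = mu * y i) ->
  final_class f C -> (forall D, final_class f D -> D = C) ->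
  exists c : R, 0 < c /\ y = (fun i => c * x i).
Proof.
move=> n0 mu0 x0 y0 fx fy fC uC.
have [c c0 [cxy cC]] := min_ratio mu C x y n0 mu0 x0 y0 fx fy uC.
have [d d0 [dyx dC]] := min_ratio mu C y x n0 mu0 y0 x0 fy fx uC.
have [k Ck] : exists k, C = scc f k by case: fC.
have kC : k \in C by rewrite Ck scc_id.
have cd : c * d = 1.
  apply: (mulIf (x:=y k)); first by rewrite gt_eqF.
  by rewrite mul1r -mulrA -dC// -cC.
exists c; split => //; apply/funext => i; apply/eqP.
rewrite eq_le cxy andbT; have := dyx i.
by rewrite -(ler_pM2l c0) mulrA cd mul1r.
Qed.

Lemma strongly_nonneg_eigen : (0 < n)%N -> strongly_nonneg f ->
  exists x, pos_eigvec f x.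
Proof.
move=> n0 sf; set mu := cw_radius f.
have mu0 : 0 < mu by exact: cw_radius_gt0.
have /choice[u Hu] : forall C, exists u, posvec u /\
    (final_class f C -> forall i, i \in C -> f u i = mu * u i).
  move=> C; have [fC|nfC] := pselect (final_class f C); last first.
    by exists (fun=> 1); split => // i; exact: ltr01.
  have [u u0 fu] := final_eigenvector C mu fC mu0 ((sf C fC.1).1 fC).
  by exists u.
(* The eigenvectors of the separate final classes are glued. A row in a final class sees only
   coordinates of that class, so each eigenvalue equation survives. *)
pose z i := u (scc f i) i.
have z0 : posvec z by move=> i; exact: (Hu _).1.
have [||y [y0 _ fy]] := eigen_extend mu z mu0 z0.
- move=> i /final_setP fi.
  rewrite /z -((Hu (scc f i)).2 fi) ?scc_id//.
  apply: (reg_dep _ _ (rf i)); [exact: posvec_nneg|exact/posvec_nneg/(Hu _).1|].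
  move=> j Dij; rewrite /z; congr u; apply: scc_eq.
  exact: (final_closed _ _ fi) (scc_id f i) Dij.
- move=> i /final_setP nfi; apply: (sf _ _).2 => //.
  by exists i.
by exists y; split => //; exists mu; apply/funext.
Qed.

(** This is [cw_radius_closed] for the whole vertex set; it gives any two positive eigenvectors a
    common eigenvalue, as the uniqueness argument requires. *)
Lemma eigen_cw_radius x : (0 < n)%N -> pos_eigvec f x ->
  forall i, f x i = cw_radius f * x i.
Proof.
move=> n0 [x0 [mu fx]]; have {}fx i : f x i = mu * x i by rewrite fx.
have mu0 : 0 < mu.
  by rewrite -(pmulr_lgt0 _ (x0 (Ordinal n0))) -fx f_gt0.
by rewrite -fJ0_setT (cw_radius_closed _ (Ordinal n0) mu x arc_closed_setT)
  ?fJ0_setT// finset.in_setT.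
Qed.

Lemma eigen_strongly_nonneg x : (0 < n)%N -> pos_eigvec f x ->
  strongly_nonneg f.
Proof.
move=> n0 ex; have fx := eigen_cw_radius x n0 ex; have [x0 _] := ex.
have mu0 := cw_radius_gt0 n0.
move=> _ [i ->]; split => fin.
  exact: (cw_radius_closed _ i _ x (final_closed _ _ fin) (scc_id f i)).
exact: cw_radius_nonfinal fx fin.
Qed.

Lemma two_final_classes C D x : (0 < n)%N -> pos_eigvec f x ->
  final_class f C -> final_class f D -> D <> C ->
  exists2 y, pos_eigvec f y & forall c, y <> (fun i => c * x i).
Proof.
move=> n0 ex fC fD DC; have fx := eigen_cw_radius x n0 ex; have [x0 _] := ex.
have mu0 := cw_radius_gt0 n0; set mu := cw_radius f in fx mu0.
have [k Ck] : exists k, C = scc f k by case: fC.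
have [l Dl] : exists l, D = scc f l by case: fD.
(* No arc joins two distinct final classes, so doubling [x] on [C] alone preserves the equations on
   all final classes. The extension has ratio 2 to [x] on [C] and 1 on [D], hence is no multiple of
   [x]. *)
pose z i := if i \in C then 2 * x i else x i.
have z0 : posvec z by move=> i; rewrite /z; case: ifP => // _; rewrite mulr_gt0.
have [||y [y0 yF fy]] := eigen_extend mu z mu0 z0.
- move=> i /final_setP fi; rewrite /z; case: ifP => iC.
    rewrite mulrCA -fx -f_hom//; last exact: posvec_nneg.
    apply: (reg_dep _ _ (rf i)); [exact: posvec_nneg| |].
      by move=> j; rewrite mulr_ge0// ltW.
    by move=> j Dij; rewrite (final_closed _ _ fC _ _ iC Dij).
  rewrite -fx; apply: (reg_dep _ _ (rf i)); try exact: posvec_nneg.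
  move=> j Dij; rewrite ifN//; apply/negP => jC.
  have ji := final_closed _ _ fi _ _ (scc_id f i) Dij.
  by rewrite (final_scc _ _ _ fC jC) (scc_eq _ _ _ ji) scc_id in iC.
- move=> i /final_setP nfi; exact: cw_radius_nonfinal nfi.
exists y; first by split => //; exists mu; apply/funext.
move=> c yc; have kC : k \in C by rewrite Ck scc_id.
have lC : l \notin C.
  by apply/negP => lC; apply: DC; rewrite Dl (final_scc _ _ _ fC lC).
have yk : y k = 2 * x k by rewrite yF /z ?kC//; apply/final_setP; rewrite -Ck.
have yl : y l = x l.
  by rewrite yF /z ?(negbTE lC)//; apply/final_setP; rewrite -Dl.
have c2 : c = 2.
  by apply: (mulIf (x:=x k)); [rewrite gt_eqF|rewrite -yk yc].
have : c = 1.
  by apply: (mulIf (x:=x l)); [rewrite gt_eqF|rewrite mul1r -[RHS]yl yc].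
lra.
Qed.

End Eigenvectors.

Theorem theorem7p1 (R : realType) (n : nat) (f : ('I_n -> R) -> ('I_n -> R)) :
  (0 < n)%N -> inMcalp f ->
  ((exists x, pos_eigvec f x) <-> strongly_nonneg f) /\
  ((exists x, pos_eigvec f x) ->
     ((forall x y, pos_eigvec f x -> pos_eigvec f y ->
         exists c : R, 0 < c /\ y = (fun i => c * x i)) <->
      (exists C, final_class f C /\ forall D, final_class f D -> D = C))).
Proof.
move=> n0 /inMcalp_regular[D rD].
have rf : regular_map f (arcb f) by rewrite (regular_arc f D rD).
split.
  split; last exact: strongly_nonneg_eigen.
  by move=> [x ex]; exact: eigen_strongly_nonneg ex.
move=> [x ex]; split.
  move=> uniq; have [j _ fj] := final_reachable f (Ordinal n0).
  exists (scc f j); split => // E fE; apply: contrapT => Ej.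
  have [y ey Hy] := two_final_classes f rf _ _ x n0 ex fj fE Ej.
  by have [c [_ /Hy]] := uniq x y ex ey.
move=> [C [fC uC]] y z ey ez.
apply: (eigen_unique f rf (cw_radius f) C) => //.
- exact: cw_radius_gt0.
- by case: ey.
- by case: ez.
- exact: eigen_cw_radius.
- exact: eigen_cw_radius.
Qed.
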